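(* Let $k$ be a field and let $X_1,\ldots,X_n,Y_1,\ldots,Y_n$ be monomials of degree at least $1$ in the variables of $k[u_1,\ldots,u_d]$, where $n\ge 3$. Let $$A=\begin{pmatrix}X_1&X_2&\cdots&X_n\\ Y_1&Y_2&\cdots&Y_n\end{pmatrix},$$ and suppose that the set $F=\{X_iY_j-X_jY_i : i\neq j\}$ of $2\times 2$ minors of $A$ consists of irreducible binomials. Then $F$ is robust if and only if the monomials $X_1,\ldots,X_n,Y_1,\ldots,Y_n$ are pairwise relatively prime.
   Context: A set $F$ of polynomials is robust if it is a Gröbner basis of the ideal $(F)$ with respect to every monomial term order and its elements minimally generate $(F)$. *)

(* Defs.v *)
From HB Require Import structures.
From mathcomp Require Import all_boot all_order all_algebra.
From mathcomp Require Import mpoly.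
Set Implicit Arguments. Unset Strict Implicit. Unset Printing Implicit Defensive.
Import GRing.Theory.
Local Open Scope ring_scope.

Section Defs.
Variables (k : fieldType) (d : nat).
Local Notation P := {mpoly k[d]}.
Local Notation M := 'X_{1..d}.

Definition gen_ideal (S : P -> Prop) (p : P) : Prop :=
  exists (m : nat) (g h : 'I_m -> P),
    (forall i, S (g i)) /\ p = \sum_(i < m) h i * g i.

Definition term_order (le : rel M) : Prop :=
  [/\ reflexive le, antisymmetric le, transitive le & total le] /\
  (forall a b c, le a b -> le (a + c)%MM (b + c)%MM) /\
  (forall a, le 0%MM a).

Definition is_LM (le : rel M) (p : P) (m : M) : Prop :=
  m \in msupp p /\ forall m', m' \in msupp p -> le m' m.

Definition LMset (le : rel M) (S : P -> Prop) (q : P) : Prop :=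
  exists (f : P) (m : M), [/\ S f, f != 0, is_LM le f m & q = 'X_[m]].

Definition groebner_basis (le : rel M) (G I : P -> Prop) : Prop :=
  (forall g, G g -> I g) /\
  (forall q, gen_ideal (LMset le G) q <-> gen_ideal (LMset le I) q).

Definition minimally_generates (F : P -> Prop) : Prop :=
  forall f, F f -> ~ gen_ideal (fun g => F g /\ g <> f) f.

Definition robust (F : P -> Prop) : Prop :=
  (forall le, term_order le -> groebner_basis le F (gen_ideal F)) /\
  minimally_generates F.

Definition irreducible_mpoly (p : P) : Prop :=
  [/\ p != 0, p \isn't a GRing.unit &
      forall a b : P, p = a * b -> a \is a GRing.unit \/ b \is a GRing.unit].

Definition is_binomial (p : P) : Prop := size (msupp p) = 2%N.

(* Monomials u^a, u^b are relatively prime: their gcd u^min(a,b) is 1. *)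
Definition mono_coprime (a b : M) : Prop :=
  [multinom minn (a i) (b i) | i < d] = 0%MM.
End Defs.

Definition minor (k : fieldType) (d n : nat) (X Y : 'I_n -> 'X_{1..d})
  (i j : 'I_n) : {mpoly k[d]} :=
  'X_[X i] * 'X_[Y j] - 'X_[X j] * 'X_[Y i].

Definition minors_set (k : fieldType) (d n : nat) (X Y : 'I_n -> 'X_{1..d})
  (p : {mpoly k[d]}) : Prop :=
  exists i j : 'I_n, (i < j)%N /\ p = minor k X Y i j.

Definition pairwise_coprime (d n : nat) (X Y : 'I_n -> 'X_{1..d}) : Prop :=
  [/\ forall i j, i != j -> mono_coprime (X i) (X j),
      forall i j, i != j -> mono_coprime (Y i) (Y j)
    & forall i j, mono_coprime (X i) (Y j)].

(* Main.v *)
Require Import Defs.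
From HB Require Import structures.
From Stdlib Require Import ClassicalEpsilon.
From mathcomp Require Import all_boot all_order all_algebra.
From mathcomp Require Import mpoly zify ring.
Set Implicit Arguments. Unset Strict Implicit. Unset Printing Implicit Defensive.
Import Order.TTheory GRing.Theory.
Local Open Scope ring_scope.

(** Coprime implies robust. Elements of the ideal [I] of minors have coefficient
    sum zero on every class of monomials modulo the lattice spanned by the
    exponents x_i + y_j - x_j - y_i. Hence the leading monomial m of an element
    of [I] is congruent to a smaller monomial m'. By coprimality m' arises from m
    by exchanging products X_i Y_j dividing m for X_j Y_i, and not all of these
    exchanges can go up, so the leading monomial of some minor divides m.

    Robust implies coprime. Irreducibility only leaves the possibility that a
    variable u divides X_i and Y_j with i <> j, say with exponents a >= b > 0. For
    l, m distinct from i and j,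
    (X_i X_j Y_l Y_m - X_l X_m Y_i Y_j) / u^b belongs to [I]; orders in which u
    dominates force every Y_l^2 to be divisible by some X_k with k distinct from
    i and j, and k runs through all these indices as l does. If a > b, refining the
    order gives Y_j | X_i; then X_k | Y_l would make the minor of columns i, l
    redundant, while otherwise the leading monomial of the binomial for (l, k) is
    divisible by no leading monomial of a minor. If a = b, the two rows play symmetric roles, and a suitable order
    leaves only the case X_i = Y_j, X_j = Y_i, in which the minor X_i^2 - X_j^2
    factors. *)

Lemma mdeg_gt0_exists d (m : 'X_{1..d}) : (0 < mdeg m)%N -> exists v, (0 < m v)%N.
Proof.
move=> m0; apply/existsP; apply: contraLR m0; rewrite negb_exists => /forallP m0.
rewrite -leqNgt leqn0 mdeg_eq0; apply/eqP/mnmP => v; rewrite mnm0E.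
by apply/eqP; have := m0 v; rewrite lt0n negbK.
Qed.

Lemma mono_coprimeP d (a b : 'X_{1..d}) :
  mono_coprime a b <-> forall v, minn (a v) (b v) = 0%N.
Proof.
split=> [/mnmP h v|h]; first by have := h v; rewrite mnmE mnm0E.
by apply/mnmP=> v; rewrite mnmE mnm0E.
Qed.

(** * Term orders in which chosen variables dominate *)

Section LexOrder.
Variable d : nat.
Implicit Types (a b c : 'X_{1..d}) (v : 'I_d) (vs : seq 'I_d).

(** Ties left by the variables in [vs] fall back on the ambient monomial order, so every list gives
    a total order, and one or two variables suffice to steer a comparison. *)
Fixpoint lex_le vs a b : bool :=
  if vs is v :: vs' then
    ((a v < b v) || (a v == b v) && lex_le vs' a b)%N
  else (a <= b)%O.

Lemma lex_le_cons_lt v vs a b : (b v < a v)%N -> ~~ lex_le (v :: vs) a b.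
Proof. by move=> /= h; rewrite ltnNge ltnW //= gtn_eqF. Qed.

Lemma lex_le_cons_eq v vs a b :
  a v = b v -> lex_le (v :: vs) a b = lex_le vs a b.
Proof. by move=> /= ->; rewrite ltnn eqxx. Qed.

Lemma lex_nle_cons v vs a b : ~~ lex_le (v :: vs) a b -> (b v <= a v)%N.
Proof. by rewrite /= negb_or -leqNgt => /andP[]. Qed.

Lemma lex_le_term_order vs : term_order (lex_le vs).
Proof.
elim: vs => [|v vs [[r a t o] [D z]]]; split=> /=.
- by split; [exact: lexx|exact: le_anti|exact: le_trans|exact: le_total].
- by split=> [a b c|a]; [rewrite lemc_add2l|rewrite le0x].
- split.
  + by move=> x; rewrite /= ltnn eqxx r.
  + move=> x y /= /andP[/orP h1 /orP h2]; apply: a.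
    case: h1 => [h1|/andP[/eqP e1 h1]]; case: h2 => [h2|/andP[/eqP e2 h2]];
      by [lia|rewrite h1 h2].
  + move=> y x w /= /orP h1 /orP h2; apply/orP.
    case: h1 => [h1|/andP[/eqP e1 h1]]; case: h2 => [h2|/andP[/eqP e2 h2]];
      try by left; lia.
    by right; rewrite e1 e2 eqxx (t _ _ _ h1 h2).
  + by move=> x y /=; case: ltngtP => //= _; exact: o.
- split=> [x y w|x]; rewrite /= ?mnmDE ?mnm0E.
    by rewrite ltn_add2r eqn_add2r => /orP[->//|/andP[-> /D ->]]; rewrite orbT.
  by rewrite z andbT; case: (x v).
Qed.

(** Needed for division to terminate. The induction is nested: on a bound for the exponent of [v],
    then on accessibility for the rest of the list, since a smaller monomial either drops at [v] or
    ties there and drops in the rest. *)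
Lemma lex_lt_wf vs : well_founded (fun a b => ~~ lex_le vs b a).
Proof.
elim: vs => [|v vs IH].
  move=> a; elim/(@ltmwf d): a => a IH; constructor=> b.
  by rewrite /= -ltNge; exact: IH.
suff acc N a : (a v < N)%N -> Acc (fun a b => ~~ lex_le (v :: vs) b a) a.
  by move=> a; apply: (acc (a v).+1).
elim: N a => [a|N IHN a]; first by rewrite ltn0.
move: (IH a); elim=> {}a _ IHa le_aN.
constructor=> b nab; have := lex_nle_cons nab.
rewrite leq_eqVlt => /orP[/eqP e|lt]; last by apply: IHN; lia.
by apply: IHa; [rewrite -(@lex_le_cons_eq v)|rewrite e].
Qed.
End LexOrder.

(** * Robust implies coprime, in terms of exponents *)

Section RobustMonomials.
Variables d n : nat.
Implicit Types (X Y : 'I_n -> 'X_{1..d}) (vs : seq 'I_d).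

(** The pair of columns is ordered so that either term of a minor may lead; the negated comparison
    is strictness in a total order. *)
Definition reducible_by X Y vs (m : 'X_{1..d}) : Prop :=
  exists k p : 'I_n, [/\ k != p, (X k + Y p <= m)%MM &
    ~~ lex_le vs (X k + Y p)%MM (X p + Y k)%MM].

Definition mixed X Y (D : 'X_{1..d}) (i j l m : 'I_n) : 'X_{1..d} :=
  ((X i - D) + X j + Y l + Y m)%MM.

(* The monomial shadow of robustness; it is invariant under exchanging the two
   rows, which the polynomial statement is only up to signs. The binomial
   [mixed X Y D i j l m - mixed Y X D j i l m] is
   (X_i X_j Y_l Y_m - X_l X_m Y_i Y_j) / D. *)
Record robust_monomials X Y : Prop := RobustMonomials {
  rm_XX : forall i j v, i != j -> minn (X i v) (X j v) = 0%N;
  rm_YY : forall i j v, i != j -> minn (Y i v) (Y j v) = 0%N;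
  rm_XY : forall i v, minn (X i v) (Y i v) = 0%N;
  rm_X : forall i, exists v, (0 < X i v)%N;
  rm_Y : forall i, exists v, (0 < Y i v)%N;
  rm_sq : forall i j, i != j -> X i = Y j -> X j = Y i -> False;
  rm_groebner : forall vs D i j l m, i != j ->
    l != i -> l != j -> m != i -> m != j ->
    (D <= X i)%MM -> (D <= Y j)%MM ->
    ~~ lex_le vs (mixed X Y D i j l m) (mixed Y X D j i l m) ->
    reducible_by X Y vs (mixed X Y D i j l m);
  rm_groebner' : forall vs D i j l m, i != j ->
    l != i -> l != j -> m != i -> m != j ->
    (D <= X i)%MM -> (D <= Y j)%MM ->
    ~~ lex_le vs (mixed Y X D j i l m) (mixed X Y D i j l m) ->
    reducible_by X Y vs (mixed Y X D j i l m);
  rm_minimal : forall vs i j k p, i != j -> k != p ->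
    (X k + Y p <= X i + Y j)%MM -> (X k + Y p)%MM != (X i + Y j)%MM ->
    ~~ lex_le vs (X k + Y p)%MM (X p + Y k)%MM ->
    ~~ lex_le vs (X i + Y j)%MM (X j + Y i)%MM -> False
}.

Lemma reducible_by_sym X Y vs m : reducible_by X Y vs m -> reducible_by Y X vs m.
Proof.
move=> [k [p [kp le lt]]]; exists p, k; split; first by rewrite eq_sym.
  by rewrite addmC.
by rewrite addmC [(Y k + _)%MM]addmC.
Qed.

Lemma robust_monomials_sym X Y : robust_monomials X Y -> robust_monomials Y X.
Proof.
case=> XX YY XY hX hY sq G G' mn; split=> //.
- by move=> i v; rewrite minnC.
- by move=> i j ij h1 h2; apply: (sq i j).
- move=> vs D i j l m ij li lj mi mj Di Dj h; apply: reducible_by_sym.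
  by apply: G' => //; rewrite eq_sym.
- move=> vs D i j l m ij li lj mi mj Di Dj h; apply: reducible_by_sym.
  by apply: G => //; rewrite eq_sym.
- move=> vs i j k p ij kp.
  rewrite [(Y k + _)%MM]addmC [(Y p + _)%MM]addmC [(Y i + _)%MM]addmC.
  by rewrite [(Y j + _)%MM]addmC; apply: mn; rewrite eq_sym.
Qed.

(* [l |-> k] is injective since a variable of [X k] lies in at most one [Y l]. *)
Lemma dominated_surj X Y (R : {set 'I_n}) : robust_monomials X Y ->
  (forall l, l \in R -> exists2 k, k \in R & forall v, (X k v <= 2 * Y l v)%N) ->
  forall k, k \in R -> exists2 l, l \in R & forall v, (X k v <= 2 * Y l v)%N.
Proof.
move=> rXY H.
pose dom (k l : 'I_n) := [forall v : 'I_d, X k v <= 2 * Y l v]%N.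
have [f fP] : exists f : 'I_n -> 'I_n,
    forall l, l \in R -> f l \in R /\ dom (f l) l.
  exists (fun l => odflt l [pick k | (k \in R) && dom k l]) => l /H[k kR kl].
  case: pickP => [k' /andP[]//|/(_ k)].
  by rewrite kR /= => /negP[]; apply/forallP.
have finj : {in R &, injective f}.
  move=> l m /fP[_ /forallP hl] /fP[_ /forallP hm] eqf.
  apply/eqP; case: eqVneq => // lm; have [v v0] := rm_X rXY (f l).
  by have := rm_YY rXY v lm; have := hl v; have := hm v; rewrite -eqf; lia.
have fR : f @: R = R.
  apply/eqP; rewrite eqEcard card_in_imset // leqnn andbT.
  by apply/subsetP=> _ /imsetP[l /fP[h _] ->].
move=> k; rewrite -{1}fR => /imsetP[l lR ->]; exists l => //.
by have [_ /forallP] := fP _ lR.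
Qed.

(** * A variable [u] shared by [X i] and [Y j] *)

Section SharedVariable.
Variables (X Y : 'I_n -> 'X_{1..d}) (i j : 'I_n) (u : 'I_d).
Hypotheses (rXY : robust_monomials X Y) (ij : i != j).
Hypotheses (uYj : (0 < Y j u)%N) (leYX : (Y j u <= X i u)%N).

Let D : 'X_{1..d} := (U_(u) *+ Y j u)%MM.
Let R := [set l : 'I_n | (l != i) && (l != j)].

Let XX := rm_XX rXY.
Let YY := rm_YY rXY.
Let XY := rm_XY rXY.

Let DE v : D v = if u == v then Y j u else 0%N.
Proof. by rewrite mulmnE mnm1E; case: eqP; rewrite ?mul1n ?mul0n. Qed.

Let Xu l : l != i -> X l u = 0%N.
Proof. by move=> li; have := XX u li; lia. Qed.

Let Yu l : l != j -> Y l u = 0%N.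
Proof. by move=> lj; have := YY u lj; lia. Qed.

Let ji : j != i. Proof. by rewrite eq_sym. Qed.

Let RP l : reflect (l != i /\ l != j) (l \in R).
Proof. by rewrite inE; apply: andP. Qed.

(** As [u] is compared first, the leading X_k Y_p has at least as much [u] as X_p Y_k, which
    excludes k = j and p = i; k = i would need more [u] than division by [D] has left. So X_k is
    coprime to X_i and X_j and must divide Y_l Y_m. *)
Lemma shared_reduction vs l m : l \in R -> m \in R ->
  ~~ lex_le (u :: vs) (mixed X Y D i j l m) (mixed Y X D j i l m) ->
  exists k p, [/\ k \in R, p != i, k != p,
   ~~ lex_le (u :: vs) (X k + Y p)%MM (X p + Y k)%MM &
   (forall v, X k v <= Y l v + Y m v)%N /\
   (forall v, Y p v <= (X i v - D v) + X j v + Y l v + Y m v)%N].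
Proof.
move=> /RP[li lj] /RP[mi mj] /(rm_groebner rXY) [] //.
- by apply/mnm_lepP=> v; rewrite DE; case: eqP => // <-.
- by apply/mnm_lepP=> v; rewrite DE; case: eqP => // <-.
move=> k [p [kp /mnm_lepP le lt]]; exists k, p.
have := lex_nle_cons lt; rewrite !mnmDE => ltu.
have leE v := le v; rewrite /mixed in leE.
have ki : k != i.
  apply/eqP=> ki; have := leE u; rewrite !mnmDE !mnmBE DE eqxx ki.
  by rewrite (Xu ji) (Yu lj) (Yu mj); lia.
have kj : k != j.
  apply/eqP=> kj; subst k; move: ltu.
  have pj : p != j by rewrite eq_sym.
  by rewrite (Xu ji) (Yu pj); lia.
have pi : p != i.
  apply/eqP=> pi; subst p; move: ltu.
  by rewrite (Xu ki) (Yu ij); lia.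
split=> //; first exact/RP.
split=> v; have := leE v; rewrite !mnmDE !mnmBE; last by clear; lia.
by have := XX v ki; have := XX v kj; clear; lia.
Qed.


Hypothesis R0 : exists l, l \in R.

Let mixedE v l m : mixed X Y D i j l m v = (X i v - D v + X j v + Y l v + Y m v)%N.
Proof. by rewrite !mnmDE mnmBE. Qed.

Let mixedE' v l m : mixed Y X D j i l m v = (Y j v - D v + Y i v + X l v + X m v)%N.
Proof. by rewrite !mnmDE mnmBE. Qed.

Lemma shared_unequal : (Y j u < X i u)%N -> False.
Proof.
move=> ltYX; have [l0 l0R] := R0.
(* After division by [D] only the X_i side still contains [u], so it leads whatever the tie-breaking
   list [vs] is. *)
have red vs l m : l \in R -> m \in R ->
    ~~ lex_le (u :: vs) (mixed X Y D i j l m) (mixed Y X D j i l m).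
  move=> /RP[li lj] /RP[mi mj]; apply: lex_le_cons_lt.
  rewrite mixedE mixedE' DE eqxx (Xu li) (Xu mi) (Yu ij); lia.
have dom l : l \in R -> exists2 k, k \in R & forall v, (X k v <= 2 * Y l v)%N.
  move=> lR; have [k [p [kR _ _ _ [h _]]]] := shared_reduction lR lR (red [::] _ _ lR lR).
  by exists k => // v; have := h v; clear; lia.
have surj := dominated_surj rXY dom.
have dvdYX : forall v, (Y j v <= X i v)%N.
  have [w w0] := rm_X rXY l0.
  (* The tie-break by [w], a variable of X_l0, excludes p = l0. Any other p in [R] has Y_p coprime
     to Y_l0, hence supported on X_i X_j, while some X_k' with k' in [R] is supported on Y_p: a
     contradiction. Only p = j is left, and it gives the divisibility. *)
  have [k [p [kR pi kp lt [hX hY]]]] := shared_reduction l0R l0R (red [:: w] _ _ l0R l0R).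
  case: (eqVneq p j) => [->|pj] in kp lt hY *.
    move=> v; have := hY v; have [_ lj] := RP _ l0R.
    have := YY v lj; have := XY j v; clear; lia.
  have [ki kj] := RP _ kR; have [li lj] := RP _ l0R.
  case: (eqVneq p l0) => [pl|pl].
    subst p; move: lt; rewrite lex_le_cons_eq; last first.
      by rewrite !mnmDE (Xu ki) (Xu li) (Yu kj) (Yu lj).
    move/lex_nle_cons; rewrite !mnmDE.
    by move: w0; have := XX w kp; have := XY l0 w; clear; lia.
  have pR : p \in R by apply/RP.
  have [k' k'R hk'] := dom _ pR; have [v v0] := rm_X rXY k'.
  have [k'i k'j] := RP _ k'R.
  move: v0; have := hk' v; have := hY v; have := YY v pl; have := XX v k'i.
  have := XX v k'j; clear; lia.
(* Otherwise X_k Y_j would properly divide X_i Y_l, and both are leading because of [u], against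
   minimality. *)
have ndvd l k : l \in R -> k \in R -> (forall v, X k v <= Y l v)%N -> False.
  move=> /RP[li lj] /RP[ki kj] h.
  apply: (@rm_minimal _ _ rXY [:: u] i l k j) => //; rewrite 1?eq_sym //.
  - by apply/mnm_lepP=> v; rewrite !mnmDE addnC leq_add.
  - apply/eqP=> /(congr1 (fun m : 'X_{1..d} => m u)).
    by rewrite !mnmDE (Xu ki) (Yu lj); lia.
  - by apply: lex_le_cons_lt; rewrite !mnmDE (Xu ki) (Xu ji) (Yu kj); lia.
  - by apply: lex_le_cons_lt; rewrite !mnmDE (Xu li) (Yu ij) (Yu lj); lia.
(* Domination itself supplies a second index k of [R]. The X_k' dividing Y_l0 Y_k is supported on a
   single Y_q, so it divides Y_l0 or Y_k, or else is constant; all three are impossible. *)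
have [k kR hk] := dom _ l0R.
have kl : k != l0.
  apply/eqP=> kl; have [v v0] := rm_X rXY k.
  by move: v0; have := hk v; have := XY l0 v; rewrite -kl; clear; lia.
have [k' [p [k'R _ _ _ [hX _]]]] := shared_reduction l0R kR (red [::] _ _ l0R kR).
have [q qR hq] := surj _ k'R.
case: (eqVneq q l0) => [ql|ql].
  apply: (ndvd l0 k') => // v; have := hX v; have := hq v; have := YY v kl.
  by rewrite ql; clear; lia.
case: (eqVneq q k) => [qk|qk].
  apply: (ndvd k k') => // v; have := hX v; have := hq v; have := YY v kl.
  by rewrite qk; clear; lia.
have [v v0] := rm_X rXY k'.
move: v0; have := hX v; have := hq v; have := YY v ql; have := YY v qk; clear; lia.
Qed.

(** Now [u] ties, and a variable [w] of Y_l decides: it is absent from X_l, Y_i and Y_j, so the side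
    with Y_l^2 leads. *)
Lemma shared_equal_dominated : Y j u = X i u -> forall l, l \in R ->
  exists2 k, k \in R & forall v, (X k v <= 2 * Y l v)%N.
Proof.
move=> eYX l lR; have [li lj] := RP _ lR; have [w w0] := rm_Y rXY l.
have [] := @shared_reduction [:: w] l l lR lR.
  rewrite lex_le_cons_eq; last first.
    by rewrite mixedE mixedE' DE eqxx (Xu li) (Yu ij) (Xu ji) (Yu lj); lia.
  apply: lex_le_cons_lt; rewrite mixedE mixedE'.
  move: w0; have := YY w lj; have := YY w li; have := XY l w; clear; lia.
move=> k [p [kR _ _ _ [h _]]].
by exists k => // v; have := h v; clear; lia.
Qed.

(** The variable [z] makes the X_i X_j side lead without affecting comparisons between columns of
    [R]. A reduction with p = j lacks [u], p = l is excluded by the tie-break [w], and any other p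
    in [R] contradicts domination. *)
Lemma shared_equal_separated z : Y j u = X i u ->
  (forall l, l \in R -> X l z = 0%N /\ Y l z = 0%N) ->
  (Y j z - D z + Y i z < X i z - D z + X j z)%N -> False.
Proof.
move=> eYX z0 ltz; have [l lR] := R0; have [li lj] := RP _ lR.
have [Xlz Ylz] := z0 _ lR; have [w w0] := rm_X rXY l.
have [] := @shared_reduction [:: z; w] l l lR lR.
  rewrite lex_le_cons_eq; last first.
    by rewrite mixedE mixedE' DE eqxx (Xu li) (Yu ij) (Xu ji) (Yu lj); lia.
  by apply: lex_le_cons_lt; rewrite mixedE mixedE' Xlz Ylz !addn0.
move=> k [p [kR pi kp lt [hX hY]]]; have [ki kj] := RP _ kR.
have [Xkz Ykz] := z0 _ kR.
have pj : p != j.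
  apply/eqP=> pj; have := hY u; rewrite pj DE eqxx (Xu ji) (Yu lj) eYX.
  by move: uYj; rewrite eYX; clear; lia.
case: (eqVneq p l) => [pl|pl].
  subst p; move: lt; rewrite lex_le_cons_eq; last first.
    by rewrite !mnmDE (Xu ki) (Xu li) (Yu kj) (Yu lj).
  rewrite lex_le_cons_eq; last by rewrite !mnmDE Xlz Ylz Xkz Ykz.
  move/lex_nle_cons; rewrite !mnmDE.
  by move: w0; have := XX w kp; have := XY l w; clear; lia.
have pR : p \in R by apply/RP.
have [k' k'R hk'] := shared_equal_dominated eYX pR; have [v v0] := rm_X rXY k'.
have [k'i k'j] := RP _ k'R.
move: v0; have := hk' v; have := hY v; have := YY v pl; have := XX v k'i.
  have := XX v k'j; clear; lia.
Qed.

End SharedVariable.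

Lemma robust_monomials_unshared_le X Y i j u : (3 <= n)%N ->
  robust_monomials X Y -> i != j ->
  (0 < Y j u)%N -> (Y j u <= X i u)%N -> False.
Proof.
move=> n3 rXY ij uYj leYX.
pose R := [set l : 'I_n | (l != i) && (l != j)].
have R0 : exists l, l \in R.
  apply/set0Pn; rewrite -card_gt0.
  have -> : R = ~: [set i; j] by apply/setP=> l; rewrite !inE negb_or.
  by rewrite -(leq_add2l #|[set i; j]|) cardsC cards2 ij card_ord addn1.
move: (leYX); rewrite leq_eqVlt => /orP[/eqP eYX|]; last exact: shared_unequal R0.
have ji : j != i by rewrite eq_sym.
have rYX := robust_monomials_sym rXY.
have R0' : exists l, l \in [set l : 'I_n | (l != j) && (l != i)].
  by case: R0 => l; rewrite inE andbC => lR; exists l; rewrite inE.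
have uXi : (0 < X i u)%N by rewrite -eYX.
have leXY : (X i u <= Y j u)%N by rewrite eYX.
have surjX := dominated_surj rXY (shared_equal_dominated rXY ij uYj leYX eYX).
have surjY := dominated_surj rYX (shared_equal_dominated rYX ji uXi leXY (esym eYX)).
pose D : 'X_{1..d} := (U_(u) *+ Y j u)%MM.
(* If [z] occurs in a column of [R], domination puts it in the other row of some column of [R] as
   well; coprimality within the rows then removes it from columns i and j, and both exponents
   vanish. *)
have z0 z : (Y j z - D z + Y i z)%N != (X i z - D z + X j z)%N ->
    forall l, l \in R -> X l z = 0%N /\ Y l z = 0%N.
  move=> neq l lR; move: (lR); rewrite inE => /andP[li lj].
  have [m + hm] := surjX _ lR; rewrite inE => /andP[mi mj].
  have [|m' + hm'] := surjY l; first by rewrite inE lj.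
  rewrite inE => /andP[mj' mi'].
  have := hm z; have := hm' z.
  have := rm_XX rXY z li; have := rm_XX rXY z lj.
  have := rm_YY rXY z li; have := rm_YY rXY z lj.
  have := rm_XX rXY z mi'; have := rm_XX rXY z mj'.
  have := rm_YY rXY z mi; have := rm_YY rXY z mj; move: neq; clear; lia.
(* With no distinguishing [z], X_i X_j = Y_i Y_j, and coprimality forces X_i = Y_j and X_j = Y_i.
   Otherwise the sign of the difference at [z] tells which row plays the role of [X]. *)
case: (altP (@forallP _ (fun z => (Y j z - D z + Y i z)%N == (X i z - D z + X j z)%N))) => [eqz|].
  have eqXY z : X i z = Y j z /\ X j z = Y i z.
    have /eqP := eqz z; rewrite /D mulmnE mnm1E; move: eYX.
    have := rm_XX rXY z ij; have := rm_YY rXY z ij.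
    have := rm_XY rXY i z; have := rm_XY rXY j z.
    by case: eqP => [<-|_]; clear; lia.
  by apply: (rm_sq rXY ij); apply/mnmP=> z; have [] := eqXY z.
rewrite negb_forall => /existsP[z neq]; have zR := z0 _ neq.
case: (ltngtP (Y j z - D z + Y i z)%N (X i z - D z + X j z)%N) => [lt|gt|eq].
- exact: (shared_equal_separated rXY ij uYj leYX R0 eYX zR lt).
- apply: (shared_equal_separated rYX ji uXi leXY R0' (esym eYX) (z := z)).
    by move=> l; rewrite inE andbC => lR; have [] := zR l; rewrite ?inE.
  by rewrite -eYX.
- by rewrite eq eqxx in neq.
Qed.

End RobustMonomials.

(** * Ideals, leading monomials and division *)

Section Ideals.
Variables (k : fieldType) (d : nat).
Local Notation P := {mpoly k[d]}.
Local Notation M := 'X_{1..d}.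
Implicit Types (S T : P -> Prop) (p q : P) (a b m : M) (le : rel M).

Lemma gen_ideal0 S : gen_ideal S 0.
Proof.
exists 0%N, (fun=> 0), (fun=> 0); split; first by case.
by rewrite big_ord0.
Qed.

Lemma gen_idealMD S (a : P) g p : S g -> gen_ideal S p -> gen_ideal S (a * g + p).
Proof.
move=> Sg [m [G [H [SG ->]]]].
exists m.+1, (fun i => odflt g (omap G (unlift ord0 i))).
exists (fun i => odflt a (omap H (unlift ord0 i))); split.
  by move=> i; case: (unlift _ _) => //= j; exact: SG.
rewrite big_ord_recl unlift_none /=; congr (_ + _).
by apply: eq_bigr => i _; rewrite liftK.
Qed.

Lemma gen_ideal_ind S (Q : P -> Prop) : Q 0 ->
  (forall (a : P) g p, S g -> Q p -> Q (a * g + p)) -> forall p, gen_ideal S p -> Q p.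
Proof.
move=> Q0 QD p [m [G [H [SG ->]]]].
elim: m G H SG => [|m IH] G H SG; first by rewrite big_ord0.
by rewrite big_ord_recl; apply: QD => //; apply: IH.
Qed.

Lemma gen_ideal_mem S g : S g -> gen_ideal S g.
Proof.
by move=> /(gen_idealMD 1) /(_ (gen_ideal0 S)); rewrite mul1r addr0.
Qed.

Lemma gen_idealD S p q : gen_ideal S p -> gen_ideal S q -> gen_ideal S (p + q).
Proof.
move=> + Sq; elim/gen_ideal_ind => [|a g {}p Sg IH]; first by rewrite add0r.
by rewrite -addrA; apply: gen_idealMD.
Qed.

Lemma gen_idealM S (a : P) p : gen_ideal S p -> gen_ideal S (a * p).
Proof.
elim/gen_ideal_ind => [|b g {}p Sg IH]; first by rewrite mulr0; apply: gen_ideal0.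
by rewrite mulrDr mulrA; apply: gen_idealMD.
Qed.

Lemma gen_idealN S p : gen_ideal S p -> gen_ideal S (- p).
Proof. by rewrite -mulN1r; apply: gen_idealM. Qed.

Lemma gen_idealB S p q : gen_ideal S p -> gen_ideal S q -> gen_ideal S (p - q).
Proof. by move=> Sp /gen_idealN; apply: gen_idealD. Qed.

Lemma gen_ideal_sub S T : (forall g, S g -> gen_ideal T g) ->
  forall p, gen_ideal S p -> gen_ideal T p.
Proof.
move=> ST p; elim/gen_ideal_ind => [|a g {}p Sg IH]; first exact: gen_ideal0.
by apply: gen_idealD => //; apply: gen_idealM; apply: ST.
Qed.

Lemma msupp_mulP p q m : m \in msupp (p * q) ->
  exists a b, [/\ a \in msupp p, b \in msupp q & m = (a + b)%MM].
Proof. by move/msuppM_le/allpairsP => [[a b] /= [? ? ->]]; exists a, b. Qed.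

Lemma msupp_gen_ideal S p m : gen_ideal S p -> m \in msupp p ->
  exists g b, [/\ S g, b \in msupp g & (b <= m)%MM].
Proof.
elim/gen_ideal_ind => [|a g {}p Sg IH]; first by rewrite msupp0.
move/msuppD_le; rewrite mem_cat => /orP[|/IH//].
move=> /msupp_mulP[c [b [_ bg ->]]]; exists g, b; split=> //.
exact: lem_addl.
Qed.

(** Turns the Gröbner basis property into divisibility: every monomial in the support of a
    combination of monomials is a multiple of one of them. *)
Lemma LMset_ideal_divides le S m : gen_ideal (LMset le S) 'X_[m] ->
  exists f b, [/\ S f, f != 0, is_LM le f b & (b <= m)%MM].
Proof.
move=> Im; have [] := msupp_gen_ideal (m := m) Im.
  by rewrite msuppX mem_head.
move=> _ [b [[f [c [Sf f0 LM ->]]] + le_bm]].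
by rewrite msuppX mem_seq1 => /eqP eb; exists f, c; split=> //; rewrite -eb.
Qed.

Lemma is_LM_unique le p a b : term_order le -> is_LM le p a -> is_LM le p b -> a = b.
Proof.
move=> [[_ anti _ _] _] [ap ha] [bp hb].
by apply: anti; rewrite ha // hb.
Qed.

Lemma is_LM_exists le p : term_order le -> p != 0 -> exists m, is_LM le p m.
Proof.
move=> [[r _ t o] _]; rewrite -msupp_eq0 /is_LM.
elim: (msupp p) => // m s IH _.
have [->|/IH [m' [m's hm']]] := eqVneq s [::].
  exists m; rewrite mem_head; split=> // m'; rewrite mem_seq1 => /eqP ->; exact: r.
have [le1|le1] := orP (o m m').
  exists m'; rewrite in_cons m's orbT; split=> // x.
  by rewrite in_cons => /orP[/eqP->//|/hm'].
exists m; rewrite mem_head; split=> // x; rewrite in_cons => /orP[/eqP->//|/hm'].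
by move=> /t; apply.
Qed.

Lemma is_LMN le p m : is_LM le p m -> is_LM le (- p) m.
Proof.
by move=> [h1 h2]; split=> [|x]; rewrite (perm_mem (msuppN p)) //; exact: h2.
Qed.

Lemma msupp_binomial a b : a != b ->
  msupp ('X_[a] - 'X_[b] : P) =i [:: a; b].
Proof.
move=> ab m; rewrite !inE mcoeff_msupp mcoeffB !mcoeffX.
have [->|am] := eqVneq m a.
  by have [e|_] := eqVneq b a; rewrite ?subr0 ?oner_neq0 // e eqxx in ab *.
by have [_|_] := eqVneq m b; rewrite sub0r oppr_eq0 ?oner_neq0 ?eqxx.
Qed.

Lemma is_LM_binomial le a b : term_order le -> a != b -> le b a ->
  is_LM le ('X_[a] - 'X_[b] : P) a.
Proof.
move=> [[r _ _ _] _] ab ba; split=> [|m]; rewrite msupp_binomial ?mem_head //.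
by rewrite !inE => /orP[]/eqP->.
Qed.

Lemma is_LM_binomialP le a b m : is_LM le ('X_[a] - 'X_[b] : P) m -> a != b ->
  (m = a /\ le b a) \/ (m = b /\ le a b).
Proof.
move=> [+ h] ab; rewrite msupp_binomial // !inE.
have {}h x : x \in [:: a; b] -> le x m by rewrite -msupp_binomial //; exact: h.
case/orP => /eqP e; [left|right]; split=> //; rewrite -e; apply: h;
  by rewrite !inE eqxx ?orbT.
Qed.

Lemma nonconstant_not_unit p m : m != 0%MM -> p@_m != 0 -> p \isn't a GRing.unit.
Proof.
move=> m0 pm; apply/negP => /andP[/eqP pE _]; move: pm.
by rewrite pE mcoeffC (negbTE m0) mulr0 eqxx.
Qed.

(* Dividing an element of the ideal whose monomials are all below [m0] never
   uses a generator with leading monomial [m0]. *)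
Lemma groebner_division le (F : P -> Prop) f m0 :
  term_order le -> well_founded (fun a b => ~~ le b a) ->
  groebner_basis le F (gen_ideal F) -> is_LM le f m0 ->
  forall m h, gen_ideal F h -> is_LM le h m -> ~~ le m0 m ->
  gen_ideal (fun g => F g /\ g <> f) h.
Proof.
move=> tle wf [_ GB] LMf; have [[r anti t o] [leD le0]] := tle.
elim/(well_founded_ind wf) => m IH h Ih LMh m0m.
have [mh hmax] := LMh.
have h0 : h != 0 by apply: contraTneq mh => ->; rewrite msupp0.
have [] := @LMset_ideal_divides le F m.
  by apply/GB; apply: gen_ideal_mem; exists h, m.
move=> g [b [Fg g0 LMg bm]]; have [bg gmax] := LMg.
have le_bm : le b m by rewrite -(submK bm) -[b in le b _]add0m; apply: leD.
have gf : g <> f.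
  move=> gf; have e : b = m0 by apply: (is_LM_unique tle LMg); rewrite gf.
  by rewrite -e le_bm in m0m.
pose c := (h@_m / g@_b)%:MP * 'X_[m - b] : P.
have Gg : gen_ideal (fun g => F g /\ g <> f) (c * g).
  by apply: gen_idealM; apply: gen_ideal_mem.
rewrite -[h](subrK (c * g)); apply: gen_idealD => //.
have [->|h'0] := eqVneq (h - c * g) 0; first exact: gen_ideal0.
have [m1 LM1] := is_LM_exists tle h'0.
have cgm : (c * g)@_m = h@_m.
  rewrite /c -mulrA mcoeffCM -{2}(submK bm) mulrC [_ * g]mulrC mcoeffMX.
  by rewrite mulrC divfK // -mcoeff_msupp.
have lt1 : ~~ le m m1.
  have [m1s _] := LM1.
  have m1m : le m1 m.
    move: m1s => /msuppB_le; rewrite mem_cat => /orP[/hmax//|].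
    rewrite /c -mulrA mul_mpolyC => /msuppZ_le; rewrite mulrC.
    move=> /msupp_mulP[x [y [/gmax xb + ->]]]; rewrite msuppX mem_seq1 => /eqP->.
    by rewrite -{2}(submK bm) [(m - b + b)%MM]addmC; apply: leD.
  apply/negP => mm1; have e : m1 = m by apply: anti; rewrite m1m.
  by move: m1s; rewrite e mcoeff_msupp mcoeffB cgm subrr eqxx.
apply: (IH m1) => //.
  apply: gen_idealB => //; apply: gen_idealM; exact: gen_ideal_mem.
apply: contra m0m => /t; apply; have [m1s _] := LM1.
by case/orP: (o m1 m) => // mm1; rewrite mm1 in lt1.
Qed.

End Ideals.

(** * From robustness of the minors to conditions on exponents *)

Section Minors.
Variables (k : fieldType) (d n : nat) (X Y : 'I_n -> 'X_{1..d}).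
Local Notation P := {mpoly k[d]}.
Local Notation F := (minors_set (k := k) X Y).
Implicit Types (i j p q : 'I_n) (le : rel 'X_{1..d}).

Lemma minorE i j : minor k X Y i j = 'X_[X i + Y j] - 'X_[X j + Y i].
Proof. by rewrite /minor -!mpolyXD. Qed.

Lemma minorC i j : minor k X Y i j = - minor k X Y j i.
Proof. by rewrite /minor opprB. Qed.

(** Since [minors_set] lists only i < j, this restores the symmetry between columns, up to sign. *)
Lemma minors_set_minor i j : i != j ->
  exists2 f, F f & f = minor k X Y i j \/ f = - minor k X Y i j.
Proof.
rewrite neq_ltn => /orP[lt|lt]; first by exists (minor k X Y i j); [exists i, j|left].
by exists (minor k X Y j i); [exists j, i|right; rewrite -minorC].
Qed.

Lemma gen_ideal_minor i j : i != j -> gen_ideal F (minor k X Y i j).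
Proof.
move=> /minors_set_minor[f Ff [<-|e]]; first exact: gen_ideal_mem.
by rewrite -[minor _ _ _ _ _]opprK -e; apply: gen_idealN; apply: gen_ideal_mem.
Qed.

Lemma minors_set_LM le f m : F f -> f != 0 -> is_LM le f m ->
  exists i j, [/\ i != j, m = (X i + Y j)%MM, le (X j + Y i)%MM m &
    (X j + Y i)%MM != m].
Proof.
move=> [i [j [lt ->]]]; rewrite minorE => f0 LM.
have ij : i != j by rewrite neq_ltn lt.
have neq : (X i + Y j)%MM != (X j + Y i)%MM.
  by apply: contra_neq f0 => ->; rewrite subrr.
have [[-> h]|[-> h]] := is_LM_binomialP LM neq.
  by exists i, j; split=> //; rewrite eq_sym.
by exists j, i; split=> //; rewrite eq_sym.
Qed.

Lemma groebner_reducible vs (a b : 'X_{1..d}) :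
  groebner_basis (lex_le vs) F (gen_ideal F) ->
  gen_ideal F ('X_[a] - 'X_[b]) -> ~~ lex_le vs a b -> reducible_by X Y vs a.
Proof.
have tle := lex_le_term_order vs; have [[r anti _ o] _] := tle.
move=> [_ GB] Iab ab.
have neq : a != b by apply: contraNneq ab => ->; exact: r.
have ba : lex_le vs b a by case/orP: (o a b) => // ab'; rewrite ab' in ab.
have [] := @LMset_ideal_divides k d (lex_le vs) F a.
  apply/GB; apply: gen_ideal_mem; exists ('X_[a] - 'X_[b]), a; split=> //.
    by apply/eqP=> e; have := msupp_binomial k neq a; rewrite e msupp0 mem_head.
  exact: is_LM_binomial.
move=> f [m [Ff f0 LM ma]]; have [i [j [ij em h neq']]] := minors_set_LM Ff f0 LM.
exists i, j; split=> //; first by rewrite -em.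
by apply: contra_neqN neq' => h'; apply: anti; rewrite em -?em h /= em.
Qed.

Lemma mixed_in_ideal D i j l m : l != i -> m != j ->
  (D <= X i)%MM -> (D <= Y j)%MM ->
  gen_ideal F ('X_[mixed X Y D i j l m] - 'X_[mixed Y X D j i l m]).
Proof.
move=> li mj DX DY.
(* The two exchanges telescope through X_i X_m Y_j Y_l / D; each cofactor contains the one entry
   that is divided by [D]. *)
have -> : 'X_[mixed X Y D i j l m] - 'X_[mixed Y X D j i l m] =
    'X_[X m + (Y j - D)] * minor k X Y i l +
    'X_[(X i - D) + Y l] * minor k X Y j m :> P.
  have E1 : 'X_[Y j] = 'X_[Y j - D] * 'X_[D] :> P by rewrite -mpolyXD submK.
  have E2 : 'X_[X i] = 'X_[X i - D] * 'X_[D] :> P by rewrite -mpolyXD submK.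
  by rewrite /mixed /minor !mpolyXD E1 E2; ring.
by apply: gen_idealD; apply: gen_idealM; apply: gen_ideal_minor; rewrite eq_sym.
Qed.

Lemma is_LM_minor le i j : term_order le ->
  ~~ le (X i + Y j)%MM (X j + Y i)%MM ->
  is_LM le (minor k X Y i j) (X i + Y j)%MM.
Proof.
move=> tle h; have [[r _ _ o] _] := tle.
rewrite minorE; apply: is_LM_binomial => //.
  by apply: contraNneq h => ->; exact: r.
by case/orP: (o (X i + Y j)%MM (X j + Y i)%MM) => // h'; rewrite h' in h.
Qed.

(** Cancelling X_i Y_j in minor (i, j) by a multiple of minor (p, q) leaves an ideal element with
    smaller leading monomial. Its division never uses minor (i, j), which is therefore redundant. *)
Lemma robust_minimal vs i j p q : robust F -> i != j -> p != q ->
  (X p + Y q <= X i + Y j)%MM -> (X p + Y q)%MM != (X i + Y j)%MM ->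
  ~~ lex_le vs (X p + Y q)%MM (X q + Y p)%MM ->
  ~~ lex_le vs (X i + Y j)%MM (X j + Y i)%MM -> False.
Proof.
move=> [GB mn] ij pq dvd neq ltpq ltij.
have tle := lex_le_term_order vs; have [[r anti t o] [leD _]] := tle.
have [f Ff ef] := minors_set_minor ij.
have LMij := is_LM_minor tle ltij; have LMpq := is_LM_minor tle ltpq.
have LMf : is_LM (lex_le vs) f (X i + Y j)%MM.
  by case: ef => -> //; apply: is_LMN.
apply: (mn f Ff); set G := gen_ideal _.
suff Gij : G (minor k X Y i j).
  by case: ef => ->; rewrite //; apply: gen_idealN.
have Gpq : G (minor k X Y p q).
  have [g Fg eg] := minors_set_minor pq.
  have gf : g <> f.
    move=> gf; have LMg : is_LM (lex_le vs) g (X p + Y q)%MM.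
      by case: eg => -> //; apply: is_LMN.
    by move: neq; rewrite (is_LM_unique tle LMg (b := (X i + Y j)%MM)) ?eqxx // gf.
  case: eg => eg; first by rewrite -eg; apply: gen_ideal_mem.
  by rewrite -[minor _ _ _ _ _]opprK -eg; apply: gen_idealN; apply: gen_ideal_mem.
pose c := ((X i + Y j) - (X p + Y q))%MM.
pose h := minor k X Y i j - 'X_[c] * minor k X Y p q.
have hE : h = 'X_[c + (X q + Y p)] - 'X_[X j + Y i].
  rewrite /h !minorE mulrBr -!mpolyXD /c submK //; ring.
rewrite -[minor k X Y i j](subrK ('X_[c] * minor k X Y p q)).
apply: gen_idealD; last exact: gen_idealM.
rewrite -/h; have [->|h0] := eqVneq h 0; first exact: gen_ideal0.
have [m LMh] := is_LM_exists tle h0.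
apply: (groebner_division tle (@lex_lt_wf d vs) (GB _ tle) LMf _ LMh).
  by apply: gen_idealB; [|apply: gen_idealM]; apply: gen_ideal_minor.
have neqh : (c + (X q + Y p))%MM != (X j + Y i)%MM.
  by apply: contra_neq h0 => e; rewrite hE e subrr.
(* Both monomials of [h] lie strictly below X_i Y_j: one is the trailing term of minor (i, j), the
   other a multiple of the trailing term of minor (p, q). *)
rewrite hE in LMh; have [[-> _]|[-> _]//] := is_LM_binomialP LMh neqh.
rewrite -(submK dvd) -/c; apply: contra ltpq => le1.
case/orP: (o (X p + Y q)%MM (X q + Y p)%MM) => // le2.
have := leD _ _ c le2; rewrite ![(_ + c)%MM]addmC => le3.
have /addmI -> : (c + (X p + Y q) = c + (X q + Y p))%MM by apply: anti; rewrite le1.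
exact: r.
Qed.

End Minors.

(** * Consequences of irreducibility of the minors *)

Section Irreducible.
Variables (k : fieldType) (d n : nat) (X Y : 'I_n -> 'X_{1..d}).
Hypothesis irr : forall i j : 'I_n, (i < j)%N ->
  irreducible_mpoly (minor k X Y i j) /\ is_binomial (minor k X Y i j).

Lemma binomial_not_unit (a b : 'X_{1..d}) : a != b ->
  ('X_[a] - 'X_[b] : {mpoly k[d]}) \isn't a GRing.unit.
Proof.
move=> ab; have [a0|a0] := eqVneq a 0%MM.
  apply: (@nonconstant_not_unit _ _ _ b); first by rewrite -a0 eq_sym.
  by rewrite -mcoeff_msupp msupp_binomial // !inE eqxx orbT.
apply: (@nonconstant_not_unit _ _ _ a) => //.
by rewrite -mcoeff_msupp msupp_binomial // !inE eqxx.
Qed.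

Lemma irreducible_minor_neq i j : i != j -> (X i + Y j)%MM != (X j + Y i)%MM.
Proof.
move=> ij; wlog lt : i j ij / (i < j)%N.
  move=> W; move: (ij); rewrite neq_ltn => /orP[|] lt; first exact: W.
  by rewrite eq_sym; apply: W => //; rewrite eq_sym.
have [[+ _ _] _] := irr lt.
by rewrite minorE; apply: contra_neq => ->; rewrite subrr.
Qed.

(** A common variable would split off, with a difference of two distinct monomials, hence a
    non-unit, as cofactor. *)
Lemma irreducible_minor_coprime i j v : i != j ->
  minn (X i v + Y j v) (X j v + Y i v) = 0%N.
Proof.
move=> ij; wlog lt : i j ij / (i < j)%N.
  move=> W; move: (ij); rewrite neq_ltn => /orP[|] lt; first exact: W.
  by rewrite minnC; apply: W => //; rewrite eq_sym.
apply/eqP; rewrite -leqn0 leqNgt; apply/negP => pos.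
have [U1 U2] : (U_(v) <= X i + Y j)%MM /\ (U_(v) <= X j + Y i)%MM.
  by split; apply/mnm_lepP=> w; rewrite mnm1E mnmDE; case: eqP => //= <-; move: pos; clear; lia.
have [[_ _ +] _] := irr lt.
move=> /(_ 'X_[U_(v)] ('X_[X i + Y j - U_(v)] - 'X_[X j + Y i - U_(v)])) [].
- rewrite minorE mulrBr -!mpolyXD; congr ('X_[_] - 'X_[_]); by rewrite [RHS]addmC submK.
- apply/negP; apply: (@nonconstant_not_unit _ _ _ U_(v)); first by rewrite mnm1_eq0.
  by rewrite mcoeffX eqxx oner_neq0.
apply/negP/binomial_not_unit.
apply: contra_neq (irreducible_minor_neq ij) => e.
by rewrite -(submK U1) e submK.
Qed.

(** The minor would be X_i^2 - X_j^2. As X_i and X_j differ, neither factor is a unit, in any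
    characteristic. *)
Lemma irreducible_minor_not_square i j : i != j ->
  (0 < mdeg (X i))%N -> (0 < mdeg (X j))%N -> X i = Y j -> X j = Y i -> False.
Proof.
move=> ij; wlog lt : i j ij / (i < j)%N.
  move=> W Xi Xj e1 e2; move: (ij); rewrite neq_ltn => /orP[|] lt; first exact: (W i j).
  by apply: (W j i) => //; rewrite eq_sym.
move=> Xi Xj e1 e2; have neq := irreducible_minor_neq ij.
have neqX : X i != X j by apply: contra_neq neq; rewrite -e1 -e2 => ->.
have [[_ _ +] _] := irr lt.
move=> /(_ ('X_[X i] - 'X_[X j]) ('X_[X i] + 'X_[X j])) [].
- by rewrite /minor -e1 -e2; ring.
- exact/negP/binomial_not_unit.
apply/negP; apply: (@nonconstant_not_unit _ _ _ (X i)).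
  by rewrite -mdeg_eq0 -lt0n.
by rewrite mcoeffD !mcoeffX eqxx [X j == _]eq_sym (negbTE neqX) addr0 oner_neq0.
Qed.

Lemma robust_robust_monomials : (1 < n)%N ->
  (forall i, 0 < mdeg (X i))%N -> (forall i, 0 < mdeg (Y i))%N ->
  robust (minors_set (k := k) X Y) -> robust_monomials X Y.
Proof.
move=> n1 X0 Y0 rF; have [GB _] := rF.
split.
- by move=> i j v /(irreducible_minor_coprime v); clear; lia.
- by move=> i j v /(irreducible_minor_coprime v); clear; lia.
(* X_i and Y_i lie in opposite terms of the minor of column i with any second column. *)
- move=> i v; have : (0 < #|[set~ i]|)%N.
    by rewrite cardsC1 card_ord -subn1 subn_gt0.
  rewrite card_gt0 => /set0Pn[j]; rewrite !inE => /(irreducible_minor_coprime v).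
  by clear; lia.
- by move=> i; apply: mdeg_gt0_exists.
- by move=> i; apply: mdeg_gt0_exists.
- by move=> i j ij; apply: irreducible_minor_not_square.
- move=> vs D i j l m ij li lj mi mj DX DY.
  apply: (groebner_reducible (k := k)); first exact: GB _ (lex_le_term_order vs).
  exact: mixed_in_ideal.
- move=> vs D i j l m ij li lj mi mj DX DY.
  apply: (groebner_reducible (k := k)); first exact: GB _ (lex_le_term_order vs).
  by rewrite -opprB; apply: gen_idealN; apply: mixed_in_ideal.
- by move=> vs i j p q; apply: (robust_minimal rF).
Qed.

End Irreducible.

(** * Linear functionals vanishing on binomial ideals *)

Section WeightedSum.
Variables (k : fieldType) (d : nat) (chi : 'X_{1..d} -> k).
Implicit Types f g : {mpoly k[d]}.

(** The linear functional with value [chi m] on the monomial [m]. *)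
Definition wsum f : k := \sum_(m <- msupp f) f@_m * chi m.

Lemma wsum_sup (s : seq 'X_{1..d}) f : uniq s -> {subset msupp f <= s} ->
  wsum f = \sum_(m <- s) f@_m * chi m.
Proof.
move=> us sub; rewrite [RHS](bigID (mem (msupp f))) /= [X in _ + X]big1 ?addr0.
  rewrite -[RHS]big_filter; apply: perm_big; apply: uniq_perm.
  - exact: msupp_uniq.
  - exact: filter_uniq.
  by move=> m; rewrite mem_filter; case: (boolP (m \in msupp f)) => //= /sub.
by move=> m /memN_msupp_eq0 ->; rewrite mul0r.
Qed.

Lemma wsumD f g : wsum (f + g) = wsum f + wsum g.
Proof.
pose s := undup (msupp f ++ msupp g).
rewrite !(@wsum_sup s) ?undup_uniq //.
- by rewrite -big_split; apply: eq_bigr => m _; rewrite mcoeffD mulrDl.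
- by move=> m h; rewrite mem_undup mem_cat h orbT.
- by move=> m h; rewrite mem_undup mem_cat h.
- by move=> m /msuppD_le h; rewrite mem_undup.
Qed.

Lemma wsumZX c m : wsum (c *: 'X_[m]) = c * chi m.
Proof.
rewrite (@wsum_sup [:: m]) //; last by move=> x /msuppZ_le; rewrite msuppX.
by rewrite big_seq1 mcoeffZ mcoeffX eqxx mulr1.
Qed.

Lemma wsum0 : wsum 0 = 0.
Proof. by rewrite /wsum msupp0 big_nil. Qed.

(** By linearity only monomial multiples of generators matter, and on these the two terms cancel. *)
Lemma wsum_binomial_ideal (S : {mpoly k[d]} -> Prop) :
  (forall g, S g -> exists a b, g = 'X_[a] - 'X_[b] /\
     forall m, chi (m + a)%MM = chi (m + b)%MM) ->
  forall f, gen_ideal S f -> wsum f = 0.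
Proof.
move=> HS f; elim/gen_ideal_ind => [|h g {}f /HS[a [b [-> chiE]]] IH].
  exact: wsum0.
rewrite wsumD IH addr0 {IH}; elim/mpolyind: h => [|c m p _ _ IH].
  by rewrite mul0r wsum0.
rewrite mulrDl wsumD IH addr0 mulrBr -!scalerAl -!mpolyXD -scaleNr.
by rewrite wsumD !wsumZX chiE mulNr subrr.
Qed.

End WeightedSum.

(** * Coprime implies robust *)

Section PairwiseCoprime.
Variables (k : fieldType) (d n : nat) (X Y : 'I_n -> 'X_{1..d}).
Local Notation P := {mpoly k[d]}.
Local Notation F := (minors_set (k := k) X Y).
Implicit Types (a b : 'I_n -> nat) (i j p q : 'I_n).

Definition rows_monomial a b : 'X_{1..d} :=
  (\sum_i (X i *+ a i + Y i *+ b i))%MM.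

(** The integer vector c = a - b has sum zero, and m - m' is the sum of c_i (x_i - y_i). Splitting c
    into two natural vectors keeps all exponents nonnegative. *)
Definition lattice_related (m m' : 'X_{1..d}) : Prop :=
  exists a b, (\sum_i a i = \sum_i b i)%N /\
    (m + rows_monomial b a = m' + rows_monomial a b)%MM.

Definition unit_vec i j : nat := (i == j).

Lemma rows_monomialD a b a' b' :
  rows_monomial (fun i => a i + a' i)%N (fun i => b i + b' i)%N =
  (rows_monomial a b + rows_monomial a' b')%MM.
Proof.
apply/mnmP=> v; rewrite mnmDE !mnm_sumE -big_split; apply: eq_bigr => i _ /=.
by rewrite !mnmDE !mulmnE; ring.
Qed.

Lemma rows_monomial_unit i j : rows_monomial (unit_vec i) (unit_vec j) = (X i + Y j)%MM.
Proof.
apply/mnmP=> v; rewrite mnm_sumE mnmDE.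
under eq_bigr do rewrite mnmDE !mulmnE.
rewrite big_split /=; congr (_ + _)%N.
  by rewrite (bigD1 i) //= big1 /unit_vec ?eqxx ?muln1 ?addn0 // => l /negbTE;
    rewrite eq_sym => ->; rewrite muln0.
by rewrite (bigD1 j) //= big1 /unit_vec ?eqxx ?muln1 ?addn0 // => l /negbTE;
  rewrite eq_sym => ->; rewrite muln0.
Qed.

Lemma sum_unit_vec i : (\sum_j unit_vec i j = 1)%N.
Proof.
rewrite (bigD1 i) //= big1 /unit_vec ?eqxx ?addn0 // => j /negbTE.
by rewrite eq_sym => ->.
Qed.

Lemma exists_sum_lt a b : (\sum_i a i = \sum_i b i)%N ->
  ~~ [forall i, a i == b i] -> exists i, (a i < b i)%N.
Proof.
move=> e neq; apply/existsP; apply: contraR neq; rewrite negb_exists => /forallP le_ba.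
have [|_] := @leqif_sum _ predT (fun i => b i == a i) b a.
  by move=> i _; split=> //; rewrite leqNgt.
rewrite e eqxx => /esym /forallP eqab.
by apply/forallP=> i; rewrite eq_sym; have := eqab i.
Qed.

Lemma lattice_related_refl m : lattice_related m m.
Proof. by exists (fun=> 0%N), (fun=> 0%N). Qed.

Lemma lattice_related_trans m1 m2 m3 :
  lattice_related m1 m2 -> lattice_related m2 m3 -> lattice_related m1 m3.
Proof.
move=> [a [b [s e]]] [a' [b' [s' e']]].
exists (fun i => a i + a' i)%N, (fun i => b i + b' i)%N.
split; first by rewrite !big_split /= s s'.
rewrite !rows_monomialD; apply/mnmP=> v.
have := congr1 (fun m : 'X_{1..d} => m v) e.
have := congr1 (fun m : 'X_{1..d} => m v) e'.
by rewrite !mnmDE; clear; lia.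
Qed.

Lemma lattice_related_minor m i j :
  lattice_related (m + (X i + Y j))%MM (m + (X j + Y i))%MM.
Proof.
exists (unit_vec i), (unit_vec j); rewrite !sum_unit_vec; split=> //.
by rewrite !rows_monomial_unit; apply/mnmP=> v; rewrite !mnmDE; clear; lia.
Qed.

(* Each exchange of [X i * Y j] for [X j * Y i] with [b i < a i], [a j < b j]
   goes up, so the whole transport from [a] to [b] does. *)
Lemma rows_monomial_le le a b : term_order le ->
  (\sum_i a i = \sum_i b i)%N ->
  (forall i j, (b i < a i)%N -> (a j < b j)%N ->
     le (X i + Y j)%MM (X j + Y i)%MM) ->
  le (rows_monomial a b) (rows_monomial b a).
Proof.
move=> [[r _ t _] [leD _]]; move sN : (\sum_i a i)%N => N; move: sN.
elim: N a b => [|N IH] a b sa sb up.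
  have a0 i : a i = 0%N.
    by apply/eqP; rewrite -leqn0 -sa (bigD1 i) //= leq_addr.
  have b0 i : b i = 0%N.
    by apply/eqP; rewrite -leqn0 sb (bigD1 i) //= leq_addr.
  suff -> : rows_monomial a b = rows_monomial b a by exact: r.
  by apply: eq_bigr => i _; rewrite a0 b0.
have [/forallP eqab|] := boolP [forall i, a i == b i].
  suff -> : rows_monomial a b = rows_monomial b a by exact: r.
  by apply: eq_bigr => i _; rewrite (eqP (eqab i)).
move=> neq.
have [i ai] : exists i, (b i < a i)%N.
  by apply: exists_sum_lt; rewrite ?sa //; apply: contra neq => /forallP e;
    apply/forallP=> i; rewrite eq_sym.
have [j bj] : exists j, (a j < b j)%N by apply: exists_sum_lt; rewrite ?sa.
(* One exchange is peeled off, lowering both sums by one. The vectors [a1] and [b1] exceed one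
   another only where [a] and [b] do, so [up] is inherited. *)
pose a1 l := (a l - unit_vec i l)%N; pose b1 l := (b l - unit_vec j l)%N.
have aE : a =1 (fun l => unit_vec i l + a1 l)%N.
  by move=> l; rewrite /a1 /unit_vec; case: eqP => [<-|]; move: ai; clear; lia.
have bE : b =1 (fun l => unit_vec j l + b1 l)%N.
  by move=> l; rewrite /b1 /unit_vec; case: eqP => [<-|]; move: bj; clear; lia.
have rE c c' c2 c2' : c =1 c2 -> c' =1 c2' -> rows_monomial c c' = rows_monomial c2 c2'.
  by move=> h h'; apply: eq_bigr => l _; rewrite h h'.
rewrite (rE _ _ _ _ aE bE) (rE _ _ _ _ bE aE) !rows_monomialD !rows_monomial_unit.
have le1 : le (rows_monomial a1 b1) (rows_monomial b1 a1).
  apply: IH.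
  - move: sa; rewrite (eq_bigr _ (fun l _ => aE l)) big_split /= sum_unit_vec.
    by rewrite add1n => -[].
  - move: sb; rewrite (eq_bigr _ (fun l _ => bE l)) big_split /= sum_unit_vec.
    by rewrite add1n => -[].
  - move=> p q; rewrite /a1 /b1 /unit_vec => hp hq; apply: up.
      by move: hp bj; case: (eqVneq j p) => [<-|_]; clear; lia.
    by move: hq ai; case: (eqVneq i q) => [<-|_]; clear; lia.
have le2 := leD _ _ (rows_monomial a1 b1) (up i j ai bj).
apply: t le2 _; rewrite ![(X j + Y i + _)%MM]addmC; exact: leD.
Qed.

(** Take for [chi] the indicator of the class of [m], so that the functional vanishes on [f]. If [m]
    were alone in its class, the value would be its nonzero coefficient. *)
Lemma minors_ideal_related f m : gen_ideal F f -> m \in msupp f ->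
  exists m', [/\ m' \in msupp f, m' != m & lattice_related m m'].
Proof.
move=> If mf; apply: NNPP => none.
pose chi m' : k := if excluded_middle_informative (lattice_related m m') then 1 else 0.
have chiE m1 i j : chi (m1 + (X i + Y j))%MM = chi (m1 + (X j + Y i))%MM.
  rewrite /chi; case: excluded_middle_informative => h;
    case: excluded_middle_informative => // h'; [case: h'|case: h].
  - exact: lattice_related_trans h (lattice_related_minor _ _ _).
  - exact: lattice_related_trans h' (lattice_related_minor _ _ _).
have : wsum chi f = 0.
  apply: (wsum_binomial_ideal _ If) => _ [i [j [_ ->]]].
  by exists (X i + Y j)%MM, (X j + Y i)%MM; rewrite minorE.
have chim : chi m = 1.
  by rewrite /chi; case: excluded_middle_informative => // -[]; exact: lattice_related_refl.
rewrite /wsum (bigD1_seq m) ?msupp_uniq //= big_seq_cond big1 ?addr0.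
  by rewrite chim mulr1 => /eqP; rewrite mcoeff_eq0 mf.
move=> m' /andP[m'f m'm]; suff -> : chi m' = 0 by rewrite mulr0.
rewrite /chi; case: excluded_middle_informative => // h.
by case: none; exists m'.
Qed.

Section Coprime.
Hypothesis XX : forall i j v, i != j -> minn (X i v) (X j v) = 0%N.
Hypothesis YY : forall i j v, i != j -> minn (Y i v) (Y j v) = 0%N.
Hypothesis XY : forall i j v, minn (X i v) (Y j v) = 0%N.

(** A variable of X_i divides no other entry of the matrix, so its exponent reads off [a i]. *)
Lemma rows_monomial_X a b i v : (0 < X i v)%N ->
  rows_monomial a b v = (X i v * a i)%N.
Proof.
move=> Xv; rewrite mnm_sumE (bigD1 i) //= big1 ?addn0.
  rewrite mnmDE !mulmnE; have -> : Y i v = 0%N by move: Xv (XY i i v); clear; lia.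
  by rewrite mul0n addn0.
move=> j ji; rewrite mnmDE !mulmnE.
have -> : Y j v = 0%N by move: Xv (XY i j v); clear; lia.
by have -> : X j v = 0%N by move: Xv (XX v ji); clear; lia.
Qed.

Lemma rows_monomial_Y a b i v : (0 < Y i v)%N ->
  rows_monomial a b v = (Y i v * b i)%N.
Proof.
move=> Yv; rewrite mnm_sumE (bigD1 i) //= big1 ?addn0.
  rewrite mnmDE !mulmnE; have -> : X i v = 0%N by move: Yv (XY i i v); clear; lia.
  by rewrite mul0n add0n.
move=> j ji; rewrite mnmDE !mulmnE.
have -> : X j v = 0%N by move: Yv (XY j i v); clear; lia.
by have -> : Y j v = 0%N by move: Yv (YY v ji); clear; lia.
Qed.

(** At a variable of X_i the relation gives [m] at least a_i - b_i times the exponent in X_i, and at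
    one of Y_j at least b_j - a_j times that in Y_j. These variables are distinct, so the bounds
    combine. *)
Lemma related_divides a b m m' i j :
  (m + rows_monomial b a = m' + rows_monomial a b)%MM ->
  (b i < a i)%N -> (a j < b j)%N -> (X i + Y j <= m)%MM.
Proof.
move=> e ai bj; apply/mnm_lepP=> v; rewrite mnmDE.
have := congr1 (fun m : 'X_{1..d} => m v) e; rewrite /= !mnmDE.
have [Xv|Xv] := posnP (X i v).
  have [Yv|Yv] := posnP (Y j v); first by rewrite Xv Yv.
  rewrite !(rows_monomial_Y _ _ Yv) Xv add0n; move: bj; clear; nia.
rewrite !(rows_monomial_X _ _ Xv).
have -> : Y j v = 0%N by move: Xv (XY i j v); clear; lia.
rewrite addn0; move: ai; clear; nia.
Qed.

Lemma coprime_groebner le : term_order le -> groebner_basis le F (gen_ideal F).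
Proof.
move=> tle; have [[r anti t o] [leD _]] := tle.
split=> [g|q]; first exact: gen_ideal_mem.
split; apply: gen_ideal_sub => g [f [m [Sf f0 LM ->]]].
  by apply: gen_ideal_mem; exists f, m; split=> //; apply: gen_ideal_mem.
have [mf fmax] := LM.
have [m' [m'f m'm [a [b [s e]]]]] := minors_ideal_related Sf mf.
have le_m'm := fmax _ m'f.
(* Either some exchange goes down, and the leading monomial of that minor divides [m]; or all go up,
   which together with m' <= m forces m = m'. *)
have [|none] := boolP [exists i, exists j, [&& (b i < a i)%N, (a j < b j)%N &
    ~~ le (X i + Y j)%MM (X j + Y i)%MM]].
  move=> /existsP[i /existsP[j /and3P[ai bj nle]]].
  have dvd := related_divides e ai bj.
  have ij : i != j by apply: contraTneq bj => <-; rewrite -leqNgt ltnW.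
  have [g' Fg' eg'] := minors_set_minor k X Y ij.
  have LMg' : is_LM le g' (X i + Y j)%MM.
    by case: eg' => ->; last apply: is_LMN; exact: is_LM_minor.
  rewrite -(submK dvd) mpolyXD; apply: gen_idealM; apply: gen_ideal_mem.
  exists g', (X i + Y j)%MM; split=> //.
  by apply/eqP=> g'0; case: LMg'; rewrite g'0 msupp0.
case/eqP: m'm; apply/anti; rewrite le_m'm /=.
have up : le (rows_monomial a b) (rows_monomial b a).
  apply: rows_monomial_le => // i j ai bj; apply: contraR none => nle.
  by apply/existsP; exists i; apply/existsP; exists j; rewrite ai bj nle.
case/orP: (o m m') => // le1.
have le2 := leD _ _ m' up; have le3 := leD _ _ (rows_monomial b a) le1.
have e1 : (m' + rows_monomial a b = m' + rows_monomial b a)%MM.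
  by apply/anti/andP; split; [rewrite ![(m' + _)%MM]addmC|rewrite -e].
suff -> : m = m' by exact: r.
by apply: (@addmI _ (rows_monomial b a)); rewrite ![(rows_monomial b a + _)%MM]addmC e.
Qed.

Hypothesis X0 : forall i, exists v, (0 < X i v)%N.
Hypothesis Y0 : forall i, exists v, (0 < Y i v)%N.

Lemma coprime_divides_eq i j p q : (X p + Y q <= X i + Y j)%MM -> p = i /\ q = j.
Proof.
move=> /mnm_lepP le; split; apply/eqP; case: eqVneq => // neq.
  have [v v0] := X0 p; have := le v; rewrite !mnmDE.
  by move: v0 (XX v neq) (XY p j v); clear; lia.
have [v v0] := Y0 q; have := le v; rewrite !mnmDE.
by move: v0 (YY v neq) (XY i q v); clear; lia.
Qed.

(** The monomial X_i Y_j of a redundant minor would be a multiple of a monomial of another minor,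
    but by coprimality it is divisible by no other product X_p Y_q. *)
Lemma coprime_minimal : minimally_generates F.
Proof.
move=> f [i [j [lt ->]]] Ig.
have ij : i != j by rewrite neq_ltn lt.
have neq : (X i + Y j)%MM != (X j + Y i)%MM.
  apply/eqP=> e; have [|ji _] := @coprime_divides_eq j i i j; first by rewrite e lepm_refl.
  by rewrite ji eqxx in ij.
have [|g [b [[[p [q [pq ->]]] ngf] bg le_b]]] := msupp_gen_ideal (m := (X i + Y j)%MM) Ig.
  by rewrite minorE msupp_binomial // mem_head.
move: bg ngf; rewrite minorE => /msuppB_le; rewrite !msuppX !inE => /orP[]/eqP eb.
  by rewrite eb in le_b; have [-> ->] := coprime_divides_eq le_b; rewrite minorE.
(* The second term X_q Y_p would give q = i and p = j, against p < q and i < j. *)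
rewrite eb in le_b; have [e1 e2] := coprime_divides_eq le_b.
by move: pq lt; rewrite e1 e2; clear; lia.
Qed.

End Coprime.

End PairwiseCoprime.

Theorem theorem4p1 (k : fieldType) (d n : nat) (X Y : 'I_n -> 'X_{1..d}) :
  (3 <= n)%N ->
  (forall i, (1 <= mdeg (X i))%N) ->
  (forall i, (1 <= mdeg (Y i))%N) ->
  (forall i j : 'I_n, (i < j)%N ->
     irreducible_mpoly (minor k X Y i j) /\ is_binomial (minor k X Y i j)) ->
  robust (minors_set (k:=k) X Y) <-> pairwise_coprime X Y.
Proof.
move=> n3 X0 Y0 irr; split=> [rF|[XX YY XY]].
  have rXY := robust_robust_monomials irr (ltnW n3) X0 Y0 rF.
  split=> [i j ij|i j ij|i j]; apply/mono_coprimeP => v.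
  - exact: rm_XX rXY _ _ _ ij.
  - exact: rm_YY rXY _ _ _ ij.
  have [->|ij] := eqVneq i j; first exact: rm_XY rXY _ _.
  apply/eqP; rewrite -leqn0 leqNgt leq_min; apply/negP => /andP[Xv Yv].
  (* If [v] has the larger exponent in Y_j, the two rows are exchanged. *)
  case/orP: (leq_total (Y j v) (X i v)) => le.
    exact: (robust_monomials_unshared_le n3 rXY ij Yv le).
  rewrite eq_sym in ij.
  exact: (robust_monomials_unshared_le n3 (robust_monomials_sym rXY) ij Xv le).
have XX' i j v : i != j -> minn (X i v) (X j v) = 0%N.
  by move=> /XX /mono_coprimeP.
have YY' i j v : i != j -> minn (Y i v) (Y j v) = 0%N.
  by move=> /YY /mono_coprimeP.
have XY' i j v : minn (X i v) (Y j v) = 0%N by have /mono_coprimeP := XY i j.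
split; first exact: coprime_groebner.
by apply: coprime_minimal => // i; apply: mdeg_gt0_exists.
Qed.
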